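(* Let $m$ be a positive integer, $n=2m$, and for $\delta\in\mathbb{F}_{2^{n}}$ write $\bar\delta=\delta^{2^m}$. Let $F(X)=(X^{2^m}+X+\delta)^{2^{2m-2}+2^{m-2}+1}+X$, viewed as a function $\mathbb{F}_{2^n}\to\mathbb{F}_{2^n}$. (1) If $\delta\in\mathbb{F}_{2^m}$, then $F$ is P$c$N for every $c\in\mathbb{F}_{2^m}\setminus\{1\}$, and $F$ is AP$c$N for every $c\in\mathbb{F}_{2^n}\setminus\mathbb{F}_{2^m}$. (2) If $\delta\in\mathbb{F}_{2^n}\setminus\mathbb{F}_{2^m}$ with ${\rm Tr}_1^{2m}(\delta)={\rm Tr}_1^m(1)$ and $p_m((\delta+\bar\delta)^{-1})\neq 0$, then $F$ is P$c$N for every $c\in\mathbb{F}_{2^m}\setminus\{1\}$, and the $c$-differential uniformity of $F$ is at most $4$ for every $c\in\mathbb{F}_{2^n}\setminus\mathbb{F}_{2^m}$.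
   Context: For $m\mid n$, ${\rm Tr}_m^n(X)=\sum_{i=0}^{n/m-1}X^{p^{mi}}$ denotes the relative trace from $\mathbb{F}_{p^n}$ to $\mathbb{F}_{p^m}$. The polynomials $p_k(X)$ are defined recursively by $p_1(X)=p_2(X)=X$ and $p_k(X)=p_{k-1}(X)+X^{2^{k-3}}p_{k-2}(X)$ for $k\ge 3$. For $F:\mathbb{F}_q\to\mathbb{F}_q$ and $a,b,c\in\mathbb{F}_q$, let ${}_c\Delta_F(a,b)$ be the number of $X\in\mathbb{F}_q$ with $F(X+a)-cF(X)=b$. The $c$-differential uniformity of $F$ is ${}_c\Delta_F=\max\{{}_c\Delta_F(a,b): a,b\in\mathbb{F}_q,\ a\neq 0 \text{ if } c=1\}$. $F$ is perfect $c$-nonlinear (P$c$N) if ${}_c\Delta_F=1$ and almost perfect $c$-nonlinear (AP$c$N) if ${}_c\Delta_F=2$.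
   Formalization: The formal theorem assumes m ≥ 2 instead of m a positive integer, because for m = 1 the exponent 2^{2m-2}+2^{m-2}+1 is not an integer and F is undefined. *)

(* Defs.v *)
From mathcomp Require Import all_boot all_order all_algebra all_field.

Set Implicit Arguments.
Unset Strict Implicit.
Unset Printing Implicit Defensive.

Import GRing.Theory.
Local Open Scope ring_scope.

(* The relative trace from F_{p^n} to F_{p^m}; only meaningful when m %| n. *)
Definition rtrace (R : nzRingType) (p m n : nat) (x : R) : R :=
  \sum_(i < n %/ m) x ^+ (p ^ (m * i)).

(* The sequence starts at index 1; the value at index 0 is junk. *)
Fixpoint p_poly (R : nzRingType) (k : nat) : {poly R} :=
  match k with
  | ((_.+1 as k2).+1 as k1).+1 =>
      p_poly R k1 + 'X^(2 ^ (k - 3)) * p_poly R k2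
  | _ => 'X
  end.

Definition cdelta (L : finFieldType) (f : L -> L) (c a b : L) : nat :=
  #|[set x | f (x + a) - c * f x == b]|.

Definition cdiff_uniformity (L : finFieldType) (f : L -> L) (c : L) : nat :=
  (\max_(ab : L * L | (c == 1%R) ==> (ab.1 != 0%R)) cdelta f c ab.1 ab.2)%N.

Definition PcN (L : finFieldType) (f : L -> L) (c : L) : Prop :=
  cdiff_uniformity f c = 1%N.

Definition APcN (L : finFieldType) (f : L -> L) (c : L) : Prop :=
  cdiff_uniformity f c = 2%N.

(* When #|L| = 2 ^ (2 * m), this is the copy of F_{2^m} inside L: see
   subF_divring_closed, card_subF and subF_unique. *)
Definition subF (L : finFieldType) (m : nat) : {set L} :=
  [set x | x ^+ (2 ^ m) == x].

(* The subtractions in the exponent are truncated, so this is the intended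
   function only for 2 <= m. *)
Definition Fdelta (L : finFieldType) (m : nat) (delta x : L) : L :=
  (x ^+ (2 ^ m) + x + delta) ^+ (2 ^ (2 * m - 2) + 2 ^ (m - 2) + 1) + x.

Lemma subF_divring_closed (L : finFieldType) (m : nat) :
  #|L| = (2 ^ (2 * m))%N -> divring_closed (subF L m).
Proof.
move=> oL; have ch2 := card_finPcharP oL isT.
have qnat : [pchar L].-nat (2 ^ m)%N.
  by rewrite pnatX (eq_pnat _ (pcharf_eq ch2)) pnat_id ?orTb.
split=> [|x y|x y]; rewrite !inE ?expr1n //.
  by move=> /eqP Hx /eqP Hy; rewrite (oppr_pchar2 ch2) exprDn_pchar // Hx Hy.
by move=> /eqP Hx /eqP Hy; rewrite expr_div_n Hx Hy.
Qed.

Lemma card_subF (L : finFieldType) (m : nat) :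
  (0 < m)%N -> #|L| = (2 ^ (2 * m))%N -> #|subF L m| = (2 ^ m)%N.
Proof.
move=> m_gt0 oL; set q := (2 ^ m)%N.
have q_gt1 : (1 < q)%N by rewrite -(expn0 2) ltn_exp2l.
have sP : size ('X^q - 'X : {poly L}) = q.+1.
  by rewrite size_polyDl size_polyXn // size_polyN size_polyX.
have XqE k : (0 < k)%N -> 'X^k - 'X = 'X * ('X^(k.-1) - 1) :> {poly L}.
  by case: k => // k _; rewrite mulrBr mulr1 exprS.
have dP : 'X^q - 'X %| \prod_(x <- enum L) ('X - x%:P).
  rewrite big_enum -finField_genPoly oL mulnC expnM -/q.
  rewrite !XqE ?expn_gt0 ?(ltnW q_gt1) // dvdp_mul2l ?polyX_eq0 //.
  have -> : (q ^ 2).-1 = (q.-1 * q.+1)%N.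
    by rewrite -[q.+1]addn1 -[q.-1]subn1 -subn_sqr exp1n subn1.
  by rewrite exprM [X in _ %| X]subrX1 dvdp_mulr.
have [s Es] := dvdp_prod_XsubC dP.
have sE : size (mask s (enum L)) = q.
  by apply: succn_inj; rewrite -sP (eqp_size Es) size_prod_XsubC.
rewrite -sE -(card_uniqP (mask_uniq (enum_uniq _) s)).
apply: eq_card => x; rewrite inE -root_prod_XsubC -(eqp_root Es).
by rewrite rootE !hornerE subr_eq0.
Qed.

Lemma subF_unique (L : finFieldType) (m : nat) (K : {set L}) :
  (0 < m)%N -> #|L| = (2 ^ (2 * m))%N ->
  divring_closed K -> #|K| = (2 ^ m)%N -> K = subF L m.
Proof.
move=> m_gt0 oL [K1 KB KV] oK; apply/eqP.
rewrite eqEcard card_subF // oK leqnn andbT; apply/subsetP => x Kx.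
have K0 : 0 \in K by rewrite -(subrr 1) KB.
have KM y z : y \in K -> z \in K -> y * z \in K.
  by move=> Ky Kz; rewrite -[z]invrK KV // -[z^-1]mul1r KV.
rewrite inE; have [->|x_nz] := eqVneq x 0; first by rewrite expr0n expn_eq0.
have oK0 : #|K :\ 0| = (2 ^ m).-1 by rewrite -oK (cardsD1 0 K) K0.
have xK0 : [set x * y | y in K :\ 0] = K :\ 0.
  apply/eqP; rewrite eqEcard card_imset ?leqnn ?andbT; last exact: mulfI.
  apply/subsetP => _ /imsetP[y /setD1P[y_nz Ky] ->].
  by rewrite !inE mulf_neq0 // KM.
have E : \prod_(y in K :\ 0) y = x ^+ (2 ^ m).-1 * \prod_(y in K :\ 0) y.
  rewrite -{1}xK0 big_imset /=; last by move=> y z _ _; apply: mulfI.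
  by rewrite big_split /= prodr_const oK0.
have nz : \prod_(y in K :\ 0) y != 0.
  by apply/prodf_neq0 => y /setD1P[].
have {}E : x ^+ (2 ^ m).-1 = 1 by apply: (mulIf nz); rewrite -E mul1r.
by rewrite -(prednK (expn_gt0 2 m : is_true (0 < 2 ^ m)%N)) exprS E mulr1.
Qed.

(* Main.v *)
Require Import Defs.
From mathcomp Require Import all_boot all_order all_algebra all_field.
From Stdlib Require Import Ring.

Set Implicit Arguments.
Unset Strict Implicit.
Unset Printing Implicit Defensive.

Import GRing.Theory.
Local Open Scope ring_scope.

(** Write [conj x] for [x ^ (2 ^ m)] and [t = x + conj x]. For [c <> 1] a solution
    [x] of [F (x + a) - c F x = b] is determined by [t], and taking fourth
    powers shows that [t] satisfies a quartic equation with additive left-hand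
    side, so that differences [d] of values of [t] satisfy
      [(1 + W (al^2 + tau al)) d^4 + V d^2 + tau V d = 0],
    where [al] and [tau] are the relative traces of [a] and [delta], [W] is the
    relative trace of [(1 + c)^-4] and [V = W al^4 + tau^4]. This bounds the
    number of solutions by 4, by 2 when [tau = 0], and by 1 when [W = 0]. For
    [tau <> 0] the bounds need that [X^3 + X + tau^-1] has no root in the field
    of [2 ^ m] elements: a nonzero [d] for [W = 0], and an identically vanishing
    left-hand side, both yield such a root. If there were a root, the trace
    condition would make the cubic split, and the closed form of [p_m] in terms
    of two of its roots would give [p_m (tau^-1) = 0]. *)

(** * Arithmetic in characteristic two *)

Section CharTwo.
Variables (R : fieldType) (ch2 : 2 \in [pchar R]).

(* [ring] with coefficients in [bool], viewed as the field of two elements,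
   decides identities modulo 2. It reifies syntactically, so the operations of
   [R] are first folded into constants that mention no structure instance. *)
Let T : Type := R.
Let add2 (x y : T) : T := (x : R) + y.
Let mul2 (x y : T) : T := (x : R) * y.
Let sub2 (x y : T) : T := (x : R) - y.
Let opp2 (x : T) : T := - (x : R).
Let zero2 : T := (0 : R).
Let one2 : T := (1 : R).

Let bool_coef (b : bool) : T := if b then one2 else zero2.

Lemma char2_ring_theory :
  ring_theory zero2 one2 add2 mul2 sub2 opp2 (@eq T).
Proof.
split=> *; rewrite /add2 /mul2 /sub2 /opp2 /zero2 /one2.
all: rewrite ?add0r ?mul1r ?mulrA ?mulrDl ?addrN ?addrA //.
- exact: addrC.
- exact: mulrC.
Qed.

Lemma bool_coef_morph :
  ring_morph zero2 one2 add2 mul2 sub2 opp2 (@eq T)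
    false true xorb andb xorb id Bool.eqb bool_coef.
Proof.
have a1 : 1 + 1 = 0 :> R by rewrite -(addrr_pchar2 ch2 1).
split=> //; rewrite /add2 /mul2 /sub2 /opp2 /zero2 /one2 /bool_coef.
- by case=> [] [] /=; rewrite ?addr0 ?add0r.
- by case=> [] [] /=; rewrite ?subr0 ?sub0r ?subrr ?(oppr_pchar2 ch2).
- by case=> [] [] /=; rewrite ?mulr0 ?mulr1.
- by move=> x; rewrite (oppr_pchar2 ch2).
- by case=> [] [].
Qed.

Add Ring char2_ring : char2_ring_theory (morphism bool_coef_morph).

Ltac ring2 :=
  rewrite ?exprSr ?expr0;
  rewrite -?[_ - _]/(sub2 _ _) -?[_ + _]/(add2 _ _) -?[_ * _]/(mul2 _ _)
          -?[- _]/(opp2 _) -?[0]/zero2 -?[1]/one2;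
  lazymatch goal with |- @eq _ ?a ?b => change (@eq T a b) end; ring.

Lemma addrr2 (x : R) : x + x = 0.
Proof. exact: addrr_pchar2. Qed.

Lemma eq_of_add0 (x y : R) : x + y = 0 -> x = y.
Proof. by move/eqP; rewrite addr_eq0 (oppr_pchar2 ch2) => /eqP. Qed.

Lemma frobD k (x y : R) : (x + y) ^+ (2 ^ k) = x ^+ (2 ^ k) + y ^+ (2 ^ k).
Proof.
by rewrite exprDn_pchar // pnatX (eq_pnat _ (pcharf_eq ch2)) pnat_id ?orTb.
Qed.

Lemma frob_inj k : injective (fun x : R => x ^+ (2 ^ k)).
Proof.
move=> x y /= Exy; apply: eq_of_add0; apply/eqP.
have : (x + y) ^+ (2 ^ k) == 0 by rewrite frobD Exy addrr2.
by rewrite expf_eq0 => /andP[].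
Qed.

Lemma frobS k (x : R) : x ^+ (2 ^ k.+1) = (x ^+ (2 ^ k)) ^+ 2.
Proof. by rewrite expnSr exprM. Qed.

(** * Artin-Schreier sums, the polynomials [p_k] and the cubic [X^3 + X + A] *)

Lemma sum_artin_schreier m (s : R) :
  \sum_(i < m) (s ^+ 2 + s) ^+ (2 ^ i) = s ^+ (2 ^ m) + s.
Proof.
elim: m => [|m IHm]; first by rewrite big_ord0 expr1 addrr2.
rewrite big_ord_recr /= IHm frobD -exprM mulnC -expnSr addrC.
by move: (_ ^+ _) (_ ^+ _) => u v; ring2.
Qed.

(* The ratio of consecutive terms of the recurrence satisfies a Riccati
   equation solved by the conjugates of a root of [X^3 + X + A]; two roots
   give two independent solutions. *)
Lemma p_poly_closed_form (A z w : R) k :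
  z ^+ 3 + z = A -> w ^+ 3 + w = A -> z * w * (z + w) = A ->
  (p_poly R k.+1).[A] =
    w * (1 + w) * z ^+ (2 ^ k) + z * (1 + z) * w ^+ (2 ^ k).
Proof.
move=> Az Aw Azw.
suff [] : (p_poly R k.+1).[A] =
    w * (1 + w) * z ^+ (2 ^ k) + z * (1 + z) * w ^+ (2 ^ k) /\
  (p_poly R k.+2).[A] =
    w * (1 + w) * z ^+ (2 ^ k.+1) + z * (1 + z) * w ^+ (2 ^ k.+1) by [].
elim: k => [|k [IH1 IH2]].
  by rewrite !hornerX -{1 2}Azw expr1; split; ring2.
split=> //; have -> : p_poly R k.+3 = p_poly R k.+2 + 'X^(2 ^ k) * p_poly R k.+1.
  by rewrite /= !subSS subn0.
have Azk : A ^+ (2 ^ k) = (z ^+ (2 ^ k)) ^+ 3 + z ^+ (2 ^ k).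
  by rewrite -Az frobD exprAC.
have Awk : A ^+ (2 ^ k) = (w ^+ (2 ^ k)) ^+ 3 + w ^+ (2 ^ k).
  by rewrite -Aw frobD exprAC.
rewrite hornerD hornerM hornerXn IH1 IH2 !frobS; move: Azk Awk.
move: (A ^+ (2 ^ k)) (z ^+ (2 ^ k)) (w ^+ (2 ^ k)) => Ak zk wk Azk Awk.
apply: eq_of_add0.
transitivity (w * (1 + w) * zk * (Ak + (zk ^+ 3 + zk))
              + z * (1 + z) * wk * (Ak + (wk ^+ 3 + wk))); first by ring2.
by rewrite -Azk -Awk addrr2 !mulr0 addr0.
Qed.

(** Squaring the closed form raises [z] and [w] to the exponent [2 ^ k], which fixes them; what
    remains is [z w (A + A)]. *)
Lemma p_poly_root (A z w : R) k : (0 < k)%N ->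
  z ^+ 3 + z = A -> w ^+ 3 + w = A -> z * w * (z + w) = A ->
  z ^+ (2 ^ k) = z -> w ^+ (2 ^ k) = w -> (p_poly R k).[A] = 0.
Proof.
case: k => // k _ Az Aw Azw zK wK; apply: (@frob_inj 1); rewrite /= expr0n.
rewrite (p_poly_closed_form _ Az Aw Azw) (frobD 1) /= !exprMn -!frobS zK wK.
transitivity (z * w * ((z ^+ 3 + z) + (w ^+ 3 + w))); first by ring2.
by rewrite Az Aw addrr2 mulr0.
Qed.

(** The quadratic is the cofactor of [X + z] in [X^3 + X + A]. The roots sum to 0, so the third one
    is [z + w]. *)
Lemma factor_cubic (A z w : R) :
  z ^+ 3 + z = A -> w ^+ 2 + z * w + z ^+ 2 + 1 = 0 ->
  w ^+ 3 + w = A /\ z * w * (z + w) = A.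
Proof.
move=> <- h; split; apply: eq_of_add0.
  transitivity ((w + z) * (w ^+ 2 + z * w + z ^+ 2 + 1)); first by ring2.
  by rewrite h mulr0.
transitivity (z * (w ^+ 2 + z * w + z ^+ 2 + 1)); first by ring2.
by rewrite h mulr0.
Qed.

(* Partial fractions: [1/A = 1/z + 1/(z+1) + 1/(z+1)^2] when [A = z(z+1)^2]. *)
Lemma inv_cubic (z : R) : z != 0 -> z + 1 != 0 ->
  1 + z^-1 ^+ 2 = 1 + (z ^+ 3 + z)^-1
    + (z^-1 ^+ 2 + z^-1) + ((z + 1)^-1 ^+ 2 + (z + 1)^-1).
Proof.
move=> z0 z1.
have Az : z ^+ 3 + z = z * (z + 1) ^+ 2 by ring2.
have -> : (z ^+ 3 + z)^-1 = z^-1 + (z + 1)^-1 + (z + 1)^-1 ^+ 2.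
  apply: (mulfI (x := z ^+ 3 + z)); first by rewrite Az mulf_neq0 ?expf_neq0.
  rewrite mulfV Az ?mulf_neq0 ?expf_neq0 //.
  have := mulfV z0; have := mulfV z1.
  move: (z^-1) ((z + 1)^-1) => y v hv hy.
  transitivity ((z * y) * (z + 1) ^+ 2
     + z * (z + 1) * ((z + 1) * v) + z * ((z + 1) * v) ^+ 2); last by ring2.
  by rewrite hv hy; ring2.
by move: (z^-1) ((z + 1)^-1) => y v; ring2.
Qed.

(** Case [W = 0]: divide by [d] and substitute [d = tau^2 X]. *)
Lemma quartic_root_cubic (tau d : R) : tau != 0 -> d != 0 ->
  d ^+ 4 + tau ^+ 4 * d ^+ 2 + tau * tau ^+ 4 * d = 0 ->
  (tau^-1 ^+ 2 * d) ^+ 3 + tau^-1 ^+ 2 * d + tau^-1 = 0.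
Proof.
move=> tau0 d0 Ed; apply: (mulfI d0); rewrite mulr0.
rewrite -[RHS](mulr0 (tau^-1 ^+ 6)) -Ed.
have := mulVf tau0; move: (tau^-1) => v hv.
transitivity (v ^+ 6 * d ^+ 4 + (v * tau) ^+ 4 * v ^+ 2 * d ^+ 2
  + (v * tau) ^+ 5 * v * d); last by ring2.
by rewrite hv; ring2.
Qed.

(** With [W = w^4], the vanishing of [V] gives [w al = tau] by extracting fourth roots; the other
    coefficient, divided by [(w tau)^3], is then the cubic. *)
Lemma degenerate_root_cubic (tau w al : R) : tau != 0 ->
  w ^+ 4 * al ^+ 4 + tau ^+ 4 = 0 ->
  1 + w ^+ 4 * (al ^+ 2 + tau * al) = 0 ->
  ((w * tau)^-1) ^+ 3 + (w * tau)^-1 + tau^-1 = 0.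
Proof.
move=> tau0; rewrite -exprMn => /eq_of_add0/(@frob_inj 2) /= wal E.
have w0 : w != 0 by apply: contraNneq tau0 => w0; rewrite -wal w0 mul0r.
rewrite invfM; have := mulVf w0; have := mulVf tau0.
move: (tau^-1) (w^-1) => v p hv hp.
transitivity (p ^+ 3 * v ^+ 3 * (1 + w ^+ 4 * (al ^+ 2 + tau * al))); last first.
  by rewrite E mulr0.
transitivity (p ^+ 3 * v ^+ 3 + (p * w) ^+ 2 * (v * tau) ^+ 2 * p * v
   + (p * w) ^+ 3 * (v * tau) ^+ 2 * v); first by rewrite hp hv; ring2.
by rewrite -wal; ring2.
Qed.

(** * The difference equation in terms of [x + conj x] *)

Section Quadratic.
Variables (m : nat) (m_ge2 : (2 <= m)%N).
Hypothesis frob2m : forall x : R, x ^+ (2 ^ (2 * m)) = x.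

Notation conj x := (x ^+ (2 ^ m)).
Notation G y := (y ^+ (2 ^ (2 * m - 2) + 2 ^ (m - 2) + 1)).
Notation F delta x := (G (conj x + x + delta) + x).

Lemma conjK (x : R) : conj (conj x) = x.
Proof. by rewrite -exprM -expnD addnn -mul2n frob2m. Qed.

Lemma conj_tr (x : R) : conj (x + conj x) = x + conj x.
Proof. by rewrite frobD conjK addrC. Qed.

(** Four times the exponent is [2^(2m) + 2^m + 4], and [2^(2m)] acts as the identity. *)
Lemma G_pow4 (y : R) : (G y) ^+ 4 = y ^+ 5 * conj y.
Proof.
rewrite -exprM !mulnDl -[4%N]/(2 ^ 2)%N -!expnD !subnK //; last first.
  by rewrite (leq_trans m_ge2) // leq_pmull.
by rewrite !exprD frob2m -[(1 * _)%N]/4%N; ring2.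
Qed.

Lemma inv_pow4 (c : R) : c != 1 ->
  (1 + c)^-1 ^+ 4 * c ^+ 4 = 1 + (1 + c)^-1 ^+ 4.
Proof.
move=> c1; have c0 : 1 + c != 0.
  by apply: contra c1 => /eqP /eq_of_add0 ->.
apply: eq_of_add0; have := mulVf c0; move: (_^-1) => u hu.
transitivity ((u * (1 + c)) ^+ 4 + 1); first by ring2.
by rewrite hu; ring2.
Qed.

Section Equation.
Variables (delta c a b : R).
Hypothesis c_neq1 : c != 1.

Let U := (1 + c)^-1 ^+ 4.
Let W := U + conj U.
Let tau := delta + conj delta.
Let alpha := a + conj a.
Let V := W * alpha ^+ 4 + tau ^+ 4.

(** Outside [G] the unknown has coefficient [1 + c]: divide by it and take fourth powers, using
    [U c^4 = 1 + U]. *)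
Lemma solution_pow4 x : F delta (x + a) - c * F delta x = b ->
  x ^+ 4 = U * ((x + conj x + alpha + delta) ^+ 5 *
                (x + conj x + alpha + conj delta))
    + (1 + U) * ((x + conj x + delta) ^+ 5 * (x + conj x + conj delta))
    + U * (a + b) ^+ 4.
Proof.
have -> : conj (x + a) + (x + a) + delta = x + conj x + alpha + delta.
  by rewrite frobD /alpha; move: (conj x) (conj a) => x' a'; ring2.
rewrite [conj x + x]addrC => Eb.
have {Eb} := congr1 (fun y => U * y ^+ 4) Eb; rewrite /= (oppr_pchar2 ch2).
rewrite !(frobD 2) !exprMn !(frobD 2) !G_pow4.
move: (inv_pow4 c_neq1) (conj_tr x) (conj_tr a); rewrite -/U -/alpha.
move: (x + conj x) alpha U => t al u Uc tK alK.
rewrite !frobD tK alK; move: (conj delta) => d'.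
rewrite -[(2 ^ 2)%N]/4%N; move: (_ ^+ 5 * _) (_ ^+ 5 * _) => y0 y1 Eb.
apply: eq_of_add0.
transitivity ((u * c ^+ 4 + (1 + u)) * (y0 + x ^+ 4)
   + (u * (y1 + (x ^+ 4 + a ^+ 4) + c ^+ 4 * (y0 + x ^+ 4)) + u * b ^+ 4)).
  by ring2.
by rewrite Uc Eb !addrr2 mul0r addr0.
Qed.

(** Only its independence of [x] matters: it cancels between two solutions. *)
Definition quartic_const :=
  U * (a + b) ^+ 4 + conj (U * (a + b) ^+ 4) + delta * conj delta * V
  + (alpha ^+ 2 + tau * alpha)
    * (W * alpha ^+ 4 + (U * delta ^+ 4 + conj U * (conj delta) ^+ 4)).

(** Add to [solution_pow4] its conjugate. As [y^5 conj y = y^4 (y conj y)], no cubic term in [t]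
    occurs, and the terms of degree 5 and 6 cancel. *)
Lemma solution_quartic x : F delta (x + a) - c * F delta x = b ->
  (1 + W * (alpha ^+ 2 + tau * alpha)) * (x + conj x) ^+ 4
    + V * (x + conj x) ^+ 2 + tau * V * (x + conj x) = quartic_const.
Proof.
move/solution_pow4; have tx4 : (x + conj x) ^+ 4 = x ^+ 4 + conj (x ^+ 4).
  by rewrite (frobD 2) [in RHS]exprAC.
rewrite /quartic_const /V /W /tau.
move: (conj_tr x) (conj_tr a) tx4; rewrite -/alpha.
move: (x + conj x) alpha U => t al u tK alK tx4 x4; move: tx4; rewrite x4.
rewrite !(frobD m) !exprMn.
rewrite !(frobD m) expr1n tK alK conjK.
move: (conj delta) (conj u) (conj a) (conj b) => d' u' a' b'.
move/(congr1 (fun y => t ^+ 4 + y)); rewrite addrr2 => Et.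
by apply: eq_of_add0; rewrite Et; ring2.
Qed.

Lemma solution_diff x y (d := x + conj x + (y + conj y)) :
  F delta (x + a) - c * F delta x = b -> F delta (y + a) - c * F delta y = b ->
  (1 + W * (alpha ^+ 2 + tau * alpha)) * d ^+ 4 + V * d ^+ 2 + tau * V * d = 0.
Proof.
move=> /solution_quartic Ex /solution_quartic Ey.
rewrite -[RHS](addrr2 quartic_const) -{1}Ex -Ey /d.
by move: (x + conj x) (y + conj y) V W tau alpha => t s v w ta al; ring2.
Qed.

(** [G] sees [x] only through its trace, so for a given trace the equation is affine in [x] with
    slope [1 + c]. *)
Lemma solution_inj x y :
  F delta (x + a) - c * F delta x = b -> F delta (y + a) - c * F delta y = b ->
  x + conj x = y + conj y -> x = y.
Proof.
move=> Ex Ey Exy; apply: (mulfI (x := 1 + c)).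
  by apply: contra c_neq1 => /eqP /eq_of_add0 ->.
have tE z : conj (z + a) + (z + a) + delta = z + conj z + alpha + delta.
  by rewrite frobD /alpha; move: (conj z) (conj a) => z' a'; ring2.
move: Ex Ey; rewrite !tE ![conj _ + _]addrC Exy.
move: (G _) (G _) => g0 g1 Ex Ey; apply: eq_of_add0.
transitivity ((g1 + (x + a) - c * (g0 + x)) + (g1 + (y + a) - c * (g0 + y))).
  by ring2.
by rewrite Ex Ey addrr2.
Qed.

(* When [delta] is fixed by the conjugation, so are all the arguments of [G],
   and the second differences of [y^6] do not depend on the base point. *)
Lemma second_solution d : conj delta = delta -> conj d = d ->
  (1 + W * alpha ^+ 2) * d ^+ 2 = W * alpha ^+ 4 ->
  exists2 x, x + conj x = d
    & F delta (x + a) - c * F delta x = F delta (0 + a) - c * F delta 0.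
Proof.
move=> deltaK dK Ed; have alK : conj alpha = alpha by exact: conj_tr.
have c0 : 1 + c != 0 by apply: contra c_neq1 => /eqP /eq_of_add0 ->.
(* This value is forced by the equation once the trace of [x] is [d]; it remains to check that its
   trace is indeed [d]. *)
pose x := (1 + c)^-1 * (G (d + alpha + delta) + G (alpha + delta)
                        + c * (G (d + delta) + G delta)).
have x4 : x ^+ 4 = U * ((d + alpha + delta) ^+ 6 + (alpha + delta) ^+ 6)
                   + (1 + U) * ((d + delta) ^+ 6 + delta ^+ 6).
  rewrite /x exprMn -/U !(frobD 2) exprMn !(frobD 2) !G_pow4.
  rewrite mulrDr mulrA (inv_pow4 c_neq1) -/U; move: (alpha) alK (U) => al alK u.
  by rewrite !(frobD m) deltaK dK alK; ring2.
have tx : x + conj x = d.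
  apply: (@frob_inj 2); rewrite /= (frobD 2) -[(2 ^ 2)%N]/4%N [conj x ^+ 4]exprAC x4.
  move: Ed; rewrite /W; move: (alpha) alK (U) => al alK u Ed.
  rewrite !(frobD m) !exprMn !(frobD m) ![conj (_ ^+ 6)]exprAC.
  rewrite !(frobD m) deltaK dK alK expr1n.
  move: Ed; move: (conj u) => u' Ed; apply: eq_of_add0.
  transitivity (d ^+ 2 * ((1 + (u + u') * al ^+ 2) * d ^+ 2
                          + (u + u') * al ^+ 4)); first by ring2.
  by rewrite Ed addrr2 mulr0.
exists x => //; rewrite !frobD -/alpha.
have -> : conj x + conj a + (x + a) + delta = d + alpha + delta.
  by rewrite -tx /alpha; move: (conj x) (conj a) => x' a'; ring2.
have conj0 : conj 0 = 0 :> R by rewrite expr0n expn_eq0.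
have -> : conj 0 + conj a + (0 + a) + delta = alpha + delta.
  by rewrite conj0 /alpha; move: (conj a) => a'; ring2.
have -> : conj x + x + delta = d + delta by rewrite -tx [x + _]addrC.
have -> : conj 0 + 0 + delta = delta.
  by rewrite conj0 !add0r.
have : (1 + c) * x = G (d + alpha + delta) + G (alpha + delta)
                        + c * (G (d + delta) + G delta) by rewrite mulVKf.
move: (x) => y; move: (G _) (G _) (G _) (G _) => g4 g3 g2 g1 Ey.
apply: eq_of_add0.
transitivity ((1 + c) * y + (g1 + g2 + c * (g3 + g4))); first by ring2.
by rewrite Ey addrr2.
Qed.

End Equation.
End Quadratic.
End CharTwo.

(** * Root counting and the cubic over finite fields *)

Lemma card_lt_size (L : finFieldType) (S : {set L}) (f : L -> L) (p : {poly L}) :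
  p != 0 -> {in S &, injective f} -> {in S, forall x, root p (f x)} ->
  (#|S| < size p)%N.
Proof.
move=> p0 f_inj f_root; rewrite cardE -(size_map f); apply: max_poly_roots p0 _ _.
  by apply/allP => _ /mapP[x + ->]; rewrite mem_enum => /f_root.
rewrite map_inj_in_uniq ?enum_uniq // => x y; rewrite !mem_enum.
exact: f_inj.
Qed.

Lemma horner_p_poly_rmorph (F K : fieldType) (f : {rmorphism F -> K}) k x :
  f (p_poly F k).[x] = (p_poly K k).[f x].
Proof.
rewrite -horner_map; congr (_.[_]).
suff [] : map_poly f (p_poly F k) = p_poly K k /\
  map_poly f (p_poly F k.+1) = p_poly K k.+1 by [].
elim: k => [|k [IH1 IH2]]; first by rewrite !map_polyX.
split=> //; case: k IH1 IH2 => [|k] IH1 IH2; first by rewrite map_polyX.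
have pE E : p_poly E k.+3 = p_poly E k.+2 + 'X^(2 ^ (k.+3 - 3)) * p_poly E k.+1.
  by [].
by rewrite !pE rmorphD rmorphM /= map_polyXn IH1 IH2.
Qed.

(* If [z] is a root of [X^3 + X + A], the trace condition forces the
   quadratic cofactor to split over the field of [2 ^ m] elements. *)
Lemma cubic_no_root (L : finFieldType) m (A z : L) :
  2 \in [pchar L] -> (0 < m)%N -> A != 0 -> z ^+ (2 ^ m) = z ->
  \sum_(i < m) A^-1 ^+ (2 ^ i) = \sum_(i < m) 1 ->
  (p_poly L m).[A] != 0 -> z ^+ 3 + z + A != 0.
Proof.
move=> ch2 m_gt0 A0 zK trA; apply: contraNneq => /(eq_of_add0 ch2) Az.
have z0 : z != 0 by apply: contraNneq A0 => z0; rewrite -Az z0 expr0n add0r.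
have z1 : z + 1 != 0.
  apply: contraNneq A0 => /(eq_of_add0 ch2) z1.
  by rewrite -Az z1 expr1n addrr2.
(* Setting [w = z s] turns the quadratic cofactor into [s^2 + s = 1 + z^-2]. By [inv_cubic] the
   right-hand side is [1 + A^-1] up to Artin-Schreier terms, hence of trace 0. *)
have tr0 : \sum_(i < m) (1 + z^-1 ^+ 2) ^+ (2 ^ i) = 0.
  under eq_bigr => i _ do rewrite (inv_cubic ch2 z0 z1) Az !(frobD ch2) expr1n
    -(frobD ch2 i (z^-1 ^+ 2)) -(frobD ch2 i ((z + 1)^-1 ^+ 2)).
  rewrite !big_split /= trA addrr2 // !sum_artin_schreier //.
  by rewrite !exprVn frobD // expr1n zK !addrr2 // !addr0.
have [K [f _]] := countable_algebraic_closure L.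
have ch2K : 2 \in [pchar K] by rewrite (fmorph_pchar f).
pose C := f (1 + z^-1 ^+ 2).
(* [s] is found in an algebraic closure; the zero trace then shows that the [2 ^ m]-power map fixes
   it. *)
have [s] := @solve_monicpoly K 2 (fun i => if i == 0%N then C else 1) isT.
rewrite !big_ord_recr big_ord0 /= add0r expr0 mulr1 mul1r expr1 => sE.
have {}sE : s ^+ 2 + s = C by rewrite sE -addrA addrr2 // addr0.
have sK : s ^+ (2 ^ m) = s.
  apply: (eq_of_add0 ch2K); rewrite -(sum_artin_schreier ch2K) sE /C.
  under eq_bigr => i _ do rewrite -rmorphXn.
  by rewrite -rmorph_sum tr0 rmorph0.
have fzK : f z ^+ (2 ^ m) = f z by rewrite -rmorphXn zK.
have fAz : f z ^+ 3 + f z = f A by rewrite -rmorphXn -rmorphD Az.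
have [|fAw fAzw] := factor_cubic (z := f z) (w := f z * s) ch2K fAz.
  have -> : (f z * s) ^+ 2 + f z * (f z * s) + f z ^+ 2 + 1 =
     f z ^+ 2 * (s ^+ 2 + s) + f z ^+ 2 + 1.
    by rewrite exprMn mulrA -expr2 -mulrDr.
  rewrite sE /C -rmorphXn -rmorphM mulrDr mulr1 -exprMn divff // expr1n.
  by rewrite rmorphD rmorph1 -addrA addrr2.
rewrite -(fmorph_eq0 f) (horner_p_poly_rmorph f); apply/eqP.
by apply: (p_poly_root ch2K m_gt0 fAz fAw fAzw fzK); rewrite exprMn fzK sK.
Qed.

(** * From solution counts to the uniformity *)

Section Uniformity.
Variables (L : finFieldType) (c : L) (f : L -> L).
Hypothesis c_neq1 : c != 1.

Lemma cdelta_le_uniformity a b : (cdelta f c a b <= cdiff_uniformity f c)%N.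
Proof.
rewrite /cdiff_uniformity -[a]/(a, b).1 -{2}[b]/(a, b).2.
apply: (@leq_bigmax_cond _ _ (fun ab => cdelta f c ab.1 ab.2)).
by rewrite (negPf c_neq1).
Qed.

Lemma uniformity_leP k : (forall a b, cdelta f c a b <= k)%N ->
  (cdiff_uniformity f c <= k)%N.
Proof. by move=> le_k; apply/bigmax_leqP => -[a b] _; apply: le_k. Qed.

Lemma PcN_of_inj : (forall a b x y, f (x + a) - c * f x = b ->
  f (y + a) - c * f y = b -> x = y) -> PcN f c.
Proof.
move=> f_inj; apply/eqP; rewrite eqn_leq; apply/andP; split.
  apply: uniformity_leP => a b; apply/card_le1_eqP => x y; rewrite !inE.
  by move=> /eqP Ex /eqP Ey; apply: f_inj Ey Ex.
apply: leq_trans (cdelta_le_uniformity 0 (f (0 + 0) - c * f 0)).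
by apply/card_gt0P; exists 0; rewrite inE.
Qed.
End Uniformity.

Lemma rtrace_double (L : finFieldType) m (x : L) : 2 \in [pchar L] ->
  rtrace 2 1 (2 * m) x = \sum_(i < m) (x + x ^+ (2 ^ m)) ^+ (2 ^ i).
Proof.
move=> ch2; rewrite /rtrace divn1 mul2n -addnn big_split_ord /= -big_split.
by apply: eq_bigr => i _; rewrite /= !mul1n frobD // expnD exprM.
Qed.

(** * Solution counts in the field of [2 ^ (2 * m)] elements *)

Section FiniteField.
Variables (L : finFieldType) (m : nat).
Hypotheses (m_ge2 : (2 <= m)%N) (oL : #|L| = (2 ^ (2 * m))%N).

Let ch2 : 2 \in [pchar L]. Proof. exact: card_finPcharP oL isT. Qed.
Let frob2m (x : L) : x ^+ (2 ^ (2 * m)) = x.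
Proof. by rewrite -oL expf_card. Qed.

Notation conj x := (x ^+ (2 ^ m)).
Notation U c := ((1 + c)^-1 ^+ 4).

Lemma conj_inv1p (c : L) : conj ((1 + c)^-1) = (1 + conj c)^-1.
Proof. by rewrite exprVn frobD // expr1n. Qed.

Lemma traceU (c : L) :
  U c + conj (U c) = ((1 + c)^-1 + conj ((1 + c)^-1)) ^+ 4.
Proof. by rewrite (frobD ch2 2) -[(2 ^ 2)%N]/4%N [conj _ ^+ 4]exprAC. Qed.

Lemma traceU_neq0 (c : L) : c \notin subF L m -> U c + conj (U c) != 0.
Proof.
move=> cK; rewrite traceU expf_neq0 //; apply: contra cK => /eqP.
move/(eq_of_add0 ch2); rewrite conj_inv1p => /invr_inj /addrI Ec.
by rewrite inE -Ec.
Qed.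

Lemma notin_subF_neq1 (c : L) : c \notin subF L m -> c != 1.
Proof. by apply: contraNneq => ->; rewrite inE expr1n. Qed.

Lemma trace_neq0 (x : L) : x \notin subF L m -> x + conj x != 0.
Proof. by apply: contra => /eqP /(eq_of_add0 ch2) Ex; rewrite inE -Ex. Qed.

(** For [c] in the subfield, [W = 0], and the relation on trace differences becomes the displayed
    quartic. *)
Lemma PcN_of_no_root (delta c : L) : c \in subF L m -> c != 1 ->
  (forall d, conj d = d -> d != 0 ->
     d ^+ 4 + (delta + conj delta) ^+ 4 * d ^+ 2
     + (delta + conj delta) * (delta + conj delta) ^+ 4 * d != 0) ->
  PcN (Fdelta m delta) c.
Proof.
rewrite inE => /eqP cK c1 no_root; apply: PcN_of_inj => // a b x y Ex Ey.
have := solution_diff ch2 m_ge2 frob2m c1 Ex Ey.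
rewrite traceU conj_inv1p cK addrr2 // expr0n !mul0r addr0 mul1r add0r => E.
apply: (solution_inj ch2 c1 Ex Ey); apply: (eq_of_add0 ch2).
have [//|d0] := eqVneq (x + conj x + (y + conj y)) 0.
suff dK : conj (x + conj x + (y + conj y)) = x + conj x + (y + conj y).
  by move: (no_root _ dK d0); rewrite E eqxx.
by rewrite frobD // !conj_tr.
Qed.

(** Fix one solution; every solution is determined by its trace difference [d] with it. The map [g]
    allows counting roots in [d^2] instead of [d]. *)
Lemma cdelta_le (delta c a b : L) k (g : L -> L) (p : {poly L}) : c != 1 ->
  injective g -> p != 0 -> (size p <= k.+1)%N ->
  (forall d, conj d = d ->
    (1 + (U c + conj (U c))
         * ((a + conj a) ^+ 2 + (delta + conj delta) * (a + conj a))) * d ^+ 4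
     + ((U c + conj (U c)) * (a + conj a) ^+ 4 + (delta + conj delta) ^+ 4)
       * d ^+ 2
     + (delta + conj delta)
       * ((U c + conj (U c)) * (a + conj a) ^+ 4 + (delta + conj delta) ^+ 4)
       * d = 0 -> root p (g d)) ->
  (cdelta (Fdelta m delta) c a b <= k)%N.
Proof.
move=> c1 g_inj p0 sp rootp; rewrite /cdelta; set S := [set x | _].
have [->|[x0 Sx0]] := set_0Vmem S; first by rewrite cards0.
rewrite -ltnS (leq_trans _ sp) //.
have SP x : x \in S -> Fdelta m delta (x + a) - c * Fdelta m delta x = b.
  by rewrite inE => /eqP.
apply: (@card_lt_size _ _ (fun x => g (x + conj x + (x0 + conj x0)))) => //.
  move=> x y /SP Ex /SP Ey /g_inj /addIr.
  exact: (solution_inj ch2 c1 Ex Ey).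
move=> x /SP Ex; apply: rootp; first by rewrite frobD // !conj_tr.
exact: (solution_diff ch2 m_ge2 frob2m c1 Ex (SP _ Sx0)).
Qed.

Lemma exists_two_solutions (delta c : L) :
  delta \in subF L m -> c \notin subF L m ->
  exists a b, (2 <= cdelta (Fdelta m delta) c a b)%N.
Proof.
rewrite inE => /eqP deltaK cK; have c1 := notin_subF_neq1 cK.
have W0 := traceU_neq0 cK; have tc0 := trace_neq0 cK.
set W := U c + conj (U c) in W0.
have WK : conj W = W by exact: conj_tr.
(* One cubic encodes both [k != 0] and [1 + W al^2 != 0] for [al = k (c + conj c)]. It has at most 3
   roots, while the subfield has at least 4 elements. *)
have [k kK kE] : exists2 k, k \in subF L m
    & k + W * (c + conj c) ^+ 2 * k ^+ 3 != 0.
  apply/exists_inP; rewrite -[[exists _ in _, _]]negbK negb_exists_in.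
  apply/negP => /forall_inP rootK.
  pose p : {poly L} := Poly [:: 0; 1; 0; W * (c + conj c) ^+ 2].
  have p0 : p != 0.
    by apply/eqP => /polyP/(_ 1%N)/eqP; rewrite coef_Poly coef0 oner_eq0.
  have := card_lt_size p0 (in2W (@inj_id L)).
  move=> /(_ (subF L m)); rewrite card_subF ?(ltnW m_ge2) // => lt_p.
  have /lt_p : {in subF L m, forall x, root p x}.
    move=> x /rootK; rewrite negbK => /eqP Ex.
    rewrite rootE horner_Poly /=; move: (W * _) Ex => e Ex.
    rewrite mul0r !(add0r, addr0) mulrDl mul1r -!mulrA [X in X == _]addrC.
    exact/eqP.
  apply/negP; rewrite -leqNgt (leq_trans (size_Poly _)) //=.
  by rewrite (leq_pexp2l (isT : 0 < 2)%N m_ge2).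
have k0 : k != 0 by apply: contraNneq kE => ->; rewrite expr0n mulr0 addr0.
pose a := c * k; have aE : a + conj a = k * (c + conj c).
  by move: kK; rewrite inE /a exprMn => /eqP ->; rewrite -mulrDl mulrC.
have aK : conj (a + conj a) = a + conj a by exact: conj_tr.
set al := a + conj a in aE aK.
have al0 : al != 0 by rewrite aE mulf_neq0.
have D0 : 1 + W * al ^+ 2 != 0.
  apply: contraNneq kE => E; apply/eqP; rewrite -[RHS](mulr0 k) -E aE mulrDr.
  rewrite mulr1 [(k * _) ^+ 2]exprMn [k ^+ 3]exprS; congr (_ + _).
  move: (k ^+ 2) (_ ^+ 2) => k2 t2; rewrite [RHS]mulrCA -mulrA.
  by congr (_ * _); rewrite mulrC -mulrA.
pose r := W * al ^+ 4 / (1 + W * al ^+ 2).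
have r0 : r != 0 by rewrite !mulf_neq0 ?invr_eq0 ?expf_neq0.
have rK : conj r = r.
  rewrite /r; move: (W) (al) WK aK => w l wK lK.
  rewrite expr_div_n frobD // expr1n ![conj (w * _)]exprMn wK.
  by rewrite [conj (l ^+ 4)]exprAC [conj (l ^+ 2)]exprAC lK.
(* The square root of [r], by inverting Frobenius. *)
pose d := r ^+ (2 ^ (2 * m).-1).
have d2 : d ^+ 2 = r by rewrite -frobS prednK ?frob2m // muln_gt0 (ltnW m_ge2).
have dK : conj d = d by rewrite /d exprAC rK.
have Ed : (1 + W * al ^+ 2) * d ^+ 2 = W * al ^+ 4.
  by rewrite d2 /r mulrC divfK.
have [x tx Ex] := second_solution ch2 m_ge2 frob2m c1 deltaK dK Ed.
exists a, (Fdelta m delta (0 + a) - c * Fdelta m delta 0).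
apply/card_gt1P; exists x, 0; rewrite !inE eqxx; split=> //; first exact/eqP.
apply: contraNneq r0 => x0; rewrite -d2 -tx x0 expr0n expn_eq0 /= addr0.
by rewrite expr0n.
Qed.

End FiniteField.

Theorem theorem3p1 (L : finFieldType) (m : nat) (hm : (2 <= m)%N)
    (hL : #|L| = (2 ^ (2 * m))%N) (delta : L) :
  (delta \in subF L m ->
     (forall c : L, c \in subF L m -> c != 1 -> PcN (Fdelta m delta) c) /\
     (forall c : L, c \notin subF L m -> APcN (Fdelta m delta) c))
  /\
  (delta \notin subF L m ->
   rtrace 2 1 (2 * m) delta = rtrace 2 1 m (1 : L) ->
   (p_poly L m).[(delta + delta ^+ (2 ^ m))^-1] != 0 ->
     (forall c : L, c \in subF L m -> c != 1 -> PcN (Fdelta m delta) c) /\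
     (forall c : L, c \notin subF L m ->
        (cdiff_uniformity (Fdelta m delta) c <= 4)%N)).
Proof.
have ch2 : 2 \in [pchar L] by exact: card_finPcharP hL isT.
have frob2m (x : L) : x ^+ (2 ^ (2 * m)) = x by rewrite -hL expf_card.
split=> [deltaK|deltaK tr pm].
  have tau0 : delta + delta ^+ (2 ^ m) = 0.
    by move: deltaK; rewrite inE => /eqP ->; rewrite addrr2.
  split=> [c cK c1|c cK].
    apply: PcN_of_no_root => // d _ d0.
    by rewrite tau0 expr0n !mul0r !addr0 expf_neq0.
  have c1 := notin_subF_neq1 cK; have W0 := traceU_neq0 hL cK.
  apply/eqP; rewrite eqn_leq; apply/andP; split; last first.
    have [a [b le2]] := exists_two_solutions hm hL deltaK cK.
    exact: leq_trans le2 (cdelta_le_uniformity _ c1 a b).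
  apply: uniformity_leP => // a b; move: (@cdelta_le L m hm hL delta c a b).
  set W := (X in 1 + X * _); set al := a + _; rewrite tau0.
  (* For [tau = 0] the relation is quadratic in [d^2]. *)
  pose p : {poly L} := Poly [:: 0; W * al ^+ 4; 1 + W * al ^+ 2].
  move=> /(_ 2 (fun x => x ^+ 2) p c1); apply.
  - exact: (@frob_inj _ ch2 1).
  (* As [W != 0], a zero middle coefficient forces [al = 0], and then the leading one is 1. *)
  - apply/eqP => /polyP p0; move: (p0 1%N) (p0 2%N).
    rewrite !coef_Poly !coef0 /= => /eqP; rewrite mulf_eq0 (negPf W0) /=.
    rewrite expf_eq0 => /eqP -> /eqP.
    by rewrite expr0n mulr0 addr0 oner_eq0.
  - exact: size_Poly.
  - move=> d _; rewrite expr0n !mul0r !addr0 => Ed.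
    rewrite rootE horner_Poly /= mul0r add0r !addr0 mulrDl -mulrA -expr2.
    by rewrite -exprM Ed.
have tau0 := trace_neq0 hL deltaK.
set tau := delta + _ in tau0 pm.
have tauK : tau ^+ (2 ^ m) = tau by exact: conj_tr.
have trA : \sum_(i < m) tau^-1^-1 ^+ (2 ^ i) = \sum_(i < m) 1.
  rewrite invrK -rtrace_double // tr /rtrace divn1.
  by apply: eq_bigr => i _; rewrite expr1n.
have no_root z : z ^+ (2 ^ m) = z -> z ^+ 3 + z + tau^-1 != 0.
  by move=> zK; apply: cubic_no_root zK trA pm; rewrite ?invr_eq0 ?(ltnW hm).
split=> [c cK c1|c cK].
  apply: PcN_of_no_root => // d dK d0; apply/eqP.
  move/(quartic_root_cubic ch2 tau0 d0)/eqP; apply/negP; apply: no_root.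
  by rewrite exprMn [_ ^+ 2 ^+ _]exprAC [tau^-1 ^+ (2 ^ m)]exprVn tauK dK.
have c1 := notin_subF_neq1 cK; apply: uniformity_leP => // a b.
move: (@cdelta_le L m hm hL delta c a b); rewrite -/tau.
set W := (X in 1 + X * _); set al := a + _.
set V := W * _ + _; set k4 := 1 + _.
pose p : {poly L} := Poly [:: 0; tau * V; V; 0; k4].
move=> /(_ 4 id p c1); apply=> //.
(* If [V] and [k4] both vanished, the cubic would have the root [(w tau)^-1] in the subfield. *)
- apply/eqP => /polyP p0; move: (p0 2%N) (p0 4%N).
  rewrite !coef_Poly !coef0 /= /V /k4 /W traceU //.
  set w := (1 + c)^-1 + _ => V0 k0; have wK : w ^+ (2 ^ m) = w by exact: conj_tr.
  have /eqP := degenerate_root_cubic ch2 tau0 V0 k0.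
  by apply/negP/no_root; rewrite exprVn exprMn wK tauK.
- exact: size_Poly.
- move=> d _ Ed; rewrite rootE horner_Poly /=; apply/eqP; rewrite -[RHS]Ed.
  by rewrite mul0r !(add0r, addr0) !mulrDl -!mulrA.
Qed.
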